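(* Let $F$ be a local nonarchimedean field of characteristic $2$, and suppose $K=F(\alpha)$ is a separable quadratic extension of $F$, where $\alpha$ is a root of an irreducible polynomial $x^2+x+c\in F[x]$. Let $\gamma\in F^\times$ represent the nontrivial element of $F^\times/N_{K/F}(K^\times)$ and let $\sigma$ be the element of $\mathrm{Gal}(K/F)$ such that $\sigma(\alpha)=\alpha+1$. Then the distinct isomorphism classes of nonassociative quaternion algebras with left nucleus $K$ are represented (each exactly once) by $(K/F,\sigma,a)$ where $a$ is chosen from the set $$\mathcal{S}(K)=\{s+\alpha,\ \gamma(s+\alpha)\mid s\in F/\{0,1\}\},$$ where $F/\{0,1\}$ denotes the quotient of the additive group of $F$ by the two-element prime field $\mathbb{F}_2=\{0,1\}$ (with $s$ running over a set of coset representatives).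
   Context: A local nonarchimedean field of characteristic $2$ is a field $\mathbb{F}_{2^f}(\!(t)\!)$ of Laurent series, $f\ge1$. By local class field theory $F^\times/N_{K/F}(K^\times)$ has order $2$ for $K/F$ separable quadratic, $N_{K/F}$ being the field norm. For a quadratic Galois extension $K/F$ with nontrivial automorphism $\sigma$ and $a\in K\smallsetminus F$, the (proper) nonassociative quaternion algebra $(K/F,\sigma,a)$ is the unital $4$-dimensional $F$-algebra $K\oplus Kt$ with $F$-bilinear multiplication determined by $(k)(k')=kk'$, $(k)(k't)=kk't$, $(kt)(k')=k\sigma(k')t$, $(kt)(k't)=k\sigma(k')a$ for $k,k'\in K$. The left nucleus of an algebra $A$ is $\{x\in A:(xy)z=x(yz)\ \forall y,z\in A\}$; for $(K/F,\sigma,a)$ with $a\in K\smallsetminus F$ it equals $K$. Isomorphism means isomorphism of $F$-algebras. *)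

(* Defs.v *)
From HB Require Import structures.
From mathcomp Require Import all_boot all_order all_algebra all_field.
From mathcomp Require Import boolp classical_sets functions cardinality fsbigop.
From mathcomp Require Import zify.

Set Implicit Arguments.
Unset Strict Implicit.
Unset Printing Implicit Defensive.

Import Order.TTheory GRing.Theory Num.Theory.
Local Open Scope classical_set_scope.
Local Open Scope ring_scope.

Section Laurent.
Variable k : fieldType.

(* k((t)): f stands for the formal series sum_i (f i) t^i over i in Z. *)
Record laurent := Laurent {
  lcoef :> int -> k;
  lcoef_bounded : exists N : int, forall i, i < N -> lcoef i = 0
}.

HB.instance Definition _ := gen_eqMixin laurent.
HB.instance Definition _ := gen_choiceMixin laurent.

Lemma laurentP (f g : laurent) : lcoef f =1 lcoef g -> f = g.
Proof.
case: f g => [f hf] [g hg] /= /funext fg.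
by case: _ / fg hg => hg; congr Laurent; apply: Prop_irrelevance.
Qed.

Lemma lzero_subproof :
  exists N : int, forall i, i < N -> (fun=> 0 : k) i = 0.
Proof. by exists 0. Qed.
Definition lzero := Laurent lzero_subproof.

Lemma lone_subproof :
  exists N : int, forall i, i < N -> (fun i : int => (i == 0)%:R : k) i = 0.
Proof. by exists 0 => i i0; rewrite lt_eqF. Qed.
Definition lone := Laurent lone_subproof.

Lemma lopp_subproof (f : laurent) :
  exists N : int, forall i, i < N -> (fun i => - f i) i = 0.
Proof.
by case: f => f [N hN] /=; exists N => i iN; rewrite hN // oppr0.
Qed.
Definition lopp f := Laurent (lopp_subproof f).

Lemma ladd_subproof (f g : laurent) :
  exists N : int, forall i, i < N -> (fun i => f i + g i) i = 0.
Proof.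
case: f g => f [N hN] [g [M hM]] /=; exists (Num.min N M) => i.
by rewrite lt_min => /andP[iN iM]; rewrite hN // hM // addr0.
Qed.
Definition ladd f g := Laurent (ladd_subproof f g).

(* Only finitely many terms of the sum are nonzero. *)
Definition lconv (f g : int -> k) (n : int) : k :=
  \sum_(i \in [set: int]) f i * g (n - i).

Lemma lconvE (f g : int -> k) (M N : int) (j : nat) :
  (forall i, i < M -> f i = 0) -> (forall i, i < N -> g i = 0) ->
  lconv f g (M + N + j%:Z)
  = \sum_(i < j.+1) f (M + i%:Z) * g (N + (j - i)%N%:Z).
Proof.
move=> hf hg; rewrite /lconv.
rewrite -(@fsbig_widen _ _ _ _ ((fun i : nat => M + i%:Z) @` `I_j.+1)) //=;
  last first.
  move=> i [_ /= hi]; case: (ltP i M) => iM; first by rewrite hf // mul0r.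
  have [Ni|jN] := ltP (M + N + j%:Z - i) N; first by rewrite hg // mulr0.
  by case: hi; exists `|i - M|%N; lia.
rewrite fsbig_image; last by move=> a b _ _ /addrI [].
rewrite -fsbig_ord; apply: eq_bigr => i _; congr (_ * g _).
by have := ltn_ord i; lia.
Qed.

Lemma lconv_bounded (f g : int -> k) (M N : int) :
  (forall i, i < M -> f i = 0) -> (forall i, i < N -> g i = 0) ->
  forall i, i < M + N -> lconv f g i = 0.
Proof.
move=> hf hg i iMN; rewrite /lconv fsbig1 // => j _.
have [jM|Mj] := ltP j M; first by rewrite hf // mul0r.
by rewrite hg ?mulr0 // ltrBlDr (lt_le_trans iMN) // addrC lerD2l.
Qed.

Lemma lmul_subproof (f g : laurent) :
  exists N : int, forall i, i < N -> lconv f g i = 0.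
Proof.
case: f g => f [N hN] [g [M hM]] /=; exists (N + M).
exact: lconv_bounded.
Qed.
Definition lmul f g := Laurent (lmul_subproof f g).

Definition ltrunc (f : int -> k) (M : int) (m : nat) : {poly k} :=
  \poly_(i < m) f (M + i%:Z).

Lemma lconv_trunc (f g : int -> k) (M N : int) (m j : nat) :
  (forall i, i < M -> f i = 0) -> (forall i, i < N -> g i = 0) -> (j < m)%N ->
  lconv f g (M + N + j%:Z) = (ltrunc f M m * ltrunc g N m)`_j.
Proof.
move=> hf hg jm; rewrite lconvE // coefM; apply: eq_bigr => i _.
have ij : (i <= j)%N by rewrite -ltnS.
by rewrite !coef_poly (leq_ltn_trans ij jm) (leq_ltn_trans (leq_subr _ _) jm).
Qed.

Lemma int_offset (M n : int) : M <= n -> exists j : nat, n = M + j%:Z.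
Proof.
by move=> Mn; exists `|n - M|%N; lia.
Qed.

Lemma coefM_eq (p p' q q' : {poly k}) (j : nat) :
  (forall i, (i <= j)%N -> p`_i = p'`_i) ->
  (forall i, (i <= j)%N -> q`_i = q'`_i) -> (p * q)`_j = (p' * q')`_j.
Proof.
move=> hp hq; rewrite !coefM; apply: eq_bigr => i _.
have ij : (i <= j)%N by rewrite -ltnS.
by rewrite hp // hq // leq_subr.
Qed.

Lemma laddA : associative ladd.
Proof. by move=> f g h; apply: laurentP => i /=; rewrite addrA. Qed.
Lemma laddC : commutative ladd.
Proof. by move=> f g; apply: laurentP => i /=; rewrite addrC. Qed.
Lemma ladd0 : left_id lzero ladd.
Proof. by move=> f; apply: laurentP => i /=; rewrite add0r. Qed.
Lemma laddN : left_inverse lzero lopp ladd.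
Proof. by move=> f; apply: laurentP => i /=; rewrite addNr. Qed.

HB.instance Definition _ :=
  GRing.isZmodule.Build laurent laddA laddC ladd0 laddN.

Lemma lmulC : commutative lmul.
Proof.
move=> f g; apply: laurentP => n /=.
have [M hf] := lcoef_bounded f; have [N hg] := lcoef_bounded g.
have [nMN|] := ltP n (M + N).
  by rewrite !(lconv_bounded hf hg, lconv_bounded hg hf) // addrC.
move=> /int_offset[j ->].
by rewrite (lconv_trunc (m := j.+1)) // mulrC (addrC M) (lconv_trunc (m := j.+1)).
Qed.

Lemma lmulA : associative lmul.
Proof.
move=> f g h; apply: laurentP => n /=.
have [M hf] := lcoef_bounded f; have [N hg] := lcoef_bounded g.
have [P hh] := lcoef_bounded h.
have hfg := lconv_bounded hf hg; have hgh := lconv_bounded hg hh.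
have [nMN|] := ltP n (M + (N + P)).
  rewrite (lconv_bounded hf hgh) // (lconv_bounded hfg hh) //.
  by rewrite -addrA.
move=> /int_offset[j ->].
rewrite (lconv_trunc (m := j.+1)) // addrA (lconv_trunc (m := j.+1)) //.
have E1 i : (i <= j)%N -> (ltrunc (lconv g h) (N + P) j.+1)`_i
    = (ltrunc g N j.+1 * ltrunc h P j.+1)`_i.
  by move=> ij; rewrite [LHS]coef_poly ltnS ij (lconv_trunc (m := j.+1)).
have E2 i : (i <= j)%N -> (ltrunc (lconv f g) (M + N) j.+1)`_i
    = (ltrunc f M j.+1 * ltrunc g N j.+1)`_i.
  by move=> ij; rewrite [LHS]coef_poly ltnS ij (lconv_trunc (m := j.+1)).
rewrite (coefM_eq (fun _ _ => erefl) E1) mulrA.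
by rewrite (coefM_eq E2 (fun _ _ => erefl)).
Qed.

Lemma lmul1 : left_id lone lmul.
Proof.
move=> f; apply: laurentP => n /=; rewrite /lconv.
rewrite -(@fsbig_widen _ _ _ _ [set 0]) //=; last first.
  by move=> i [_ /= /eqP /negPf ->]; rewrite mul0r.
by rewrite fsbig_set1 eqxx mul1r subr0.
Qed.

Lemma lmulDl : left_distributive lmul ladd.
Proof.
move=> f g h; apply: laurentP => n /=.
have [M hf] := lcoef_bounded f; have [N hg] := lcoef_bounded g.
have [P hh] := lcoef_bounded h.
pose L := Num.min M N.
have hf' i : i < L -> f i = 0 by rewrite lt_min => /andP[/hf].
have hg' i : i < L -> g i = 0 by rewrite lt_min => /andP[_ /hg].
have hfg i : i < L -> ladd f g i = 0.
  by move=> iL /=; rewrite hf' // hg' // addr0.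
have [nLP|] := ltP n (L + P).
  by rewrite !(lconv_bounded hfg hh, lconv_bounded hf' hh,
    lconv_bounded hg' hh) // addr0.
move=> /int_offset[j ->].
rewrite (lconvE _ hfg) // !lconvE // -big_split /=.
by apply: eq_bigr => i _; rewrite mulrDl.
Qed.

Lemma lone_neq0 : lone != 0 :> laurent.
Proof.
apply/eqP => /(congr1 (fun f : laurent => f 0)) /= /eqP.
by rewrite oner_eq0.
Qed.

HB.instance Definition _ := GRing.Zmodule_isComNzRing.Build laurent
  lmulA lmulC lmul1 lmulDl lone_neq0.

Fixpoint linv_seq (p : nat -> k) (n : nat) : seq k :=
  if n is m.+1 then
    let s := linv_seq p m in
    rcons s (- (p 0%N)^-1 * \sum_(i < m.+1) p i.+1 * s`_(m - i))
  else [:: (p 0%N)^-1].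

Lemma size_linv_seq p n : size (linv_seq p n) = n.+1.
Proof. by elim: n => //= n IH; rewrite size_rcons IH. Qed.

Lemma nth_linv_seq p n m : (m <= n)%N ->
  (linv_seq p n)`_m = (linv_seq p m)`_m.
Proof.
elim: n => [|n IH]; first by rewrite leqn0 => /eqP ->.
rewrite leq_eqVlt => /orP[/eqP -> //|]; rewrite ltnS => mn.
by rewrite /= nth_rcons size_linv_seq ltnS mn IH.
Qed.

Lemma linv_seqP (p : nat -> k) (j : nat) : p 0%N != 0 ->
  \sum_(i < j.+1) p i * (linv_seq p (j - i))`_(j - i) = (j == 0)%:R.
Proof.
move=> p0; rewrite big_ord_recl subn0.
case: j => [|j]; first by rewrite big_ord0 addr0 /= mulfV.
rewrite /= nth_rcons size_linv_seq ltnn eqxx mulrA mulrN mulfV // mulN1r.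
apply/eqP; rewrite addrC subr_eq0; apply/eqP; apply: eq_bigr => i _.
by rewrite /bump /= add1n subSS [in RHS]nth_linv_seq // leq_subr.
Qed.

Lemma laurent_lead (f : laurent) : f != 0 ->
  exists M : int, f M != 0 /\ forall i, i < M -> f i = 0.
Proof.
move=> f0; have [N hN] := lcoef_bounded f.
have ex : exists j : nat, f (N + j%:Z) != 0.
  apply: contrapT => /forallNP h; move/eqP: f0; apply; apply: laurentP => i.
  have [iN|/int_offset[j ->]] := ltP i N; first by rewrite hN.
  by have /negP := h j; rewrite negbK => /eqP.
case: (ex_minnP ex) => j fj jmin; exists (N + j%:Z); split=> // i iNj.
have [iN|/int_offset[l def_i]] := ltP i N; first by rewrite hN.
apply/eqP; apply: contraTT iNj => fi.
by rewrite def_i -leNgt lerD2l lez_nat jmin // -def_i.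
Qed.

Lemma laurent_inv_ex (f : laurent) : f != 0 -> exists g : laurent, f * g = 1.
Proof.
move=> /laurent_lead[M [fM hM]].
pose p (i : nat) := f (M + i%:Z).
pose g (i : int) :=
  if i < - M then 0 else (linv_seq p (absz (i + M)))`_(absz (i + M)).
have hg i : i < - M -> g i = 0 by rewrite /g => ->.
exists (Laurent (ex_intro _ (- M) hg)); apply: laurentP => n.
have [n0|] := ltP n 0.
  rewrite [LHS](lconv_bounded hM hg) ?subrr //.
  by rewrite [RHS](_ : _ = (n == 0)%:R) // lt_eqF.
move=> /int_offset[j ->]; rewrite [LHS]/= -{1}(subrr M) (lconvE _ hM hg).
rewrite add0r [RHS](_ : _ = (j == 0)%:R) //.
rewrite -(@linv_seqP p) ?/p ?addr0 //; apply: eq_bigr => i _.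
congr (_ * _); rewrite /g ltNge lerDl /= addrC addrA subrr add0r.
by rewrite absz_nat.
Qed.

Definition linv (f : laurent) : laurent := xget 0 [set g | f * g = 1].

Lemma lmulVf (f : laurent) : f != 0 -> linv f * f = 1.
Proof.
move=> /laurent_inv_ex[g fg]; rewrite mulrC /linv.
by case: xgetP => [h _ //|/(_ g)].
Qed.

Lemma linv0 : linv 0 = 0.
Proof.
rewrite /linv; case: xgetP => // h _ /= /eqP.
by rewrite mul0r eq_sym oner_eq0.
Qed.

HB.instance Definition _ := GRing.ComNzRing_isField.Build laurent lmulVf linv0.

End Laurent.

Record naAlgebra (F : fieldType) := NAAlgebra {
  na_sort :> lmodType F;
  na_mul : na_sort -> na_sort -> na_sort;
  na_one : na_sort;
  na_mul_linear_r : forall x, linear (na_mul x);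
  na_mul_linear_l : forall y, linear (na_mul^~ y);
  na_mul1x : left_id na_one na_mul;
  na_mulx1 : right_id na_one na_mul
}.

Definition na_isomorphic (F : fieldType) (A B : naAlgebra F) : Prop :=
  exists f : {linear A -> B},
    bijective f /\ forall x y, f (na_mul x y) = na_mul (f x) (f y).

Definition left_nucleus (F : fieldType) (A : naAlgebra F) : set A :=
  [set x | forall y z, na_mul (na_mul x y) z = na_mul x (na_mul y z)].

(* The left nucleus of A is an F-algebra isomorphic to K. *)
Definition has_left_nucleus (F : fieldType) (A : naAlgebra F)
    (K : fieldExtType F) : Prop :=
  exists i : {linear K -> A},
    [/\ injective i,
        i 1 = na_one A,
        forall x y, i (x * y) = na_mul (i x) (i y)
      & range i = @left_nucleus F A].

Section NonassocQuaternion.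
Variables (F : fieldType) (K : splittingFieldType F).
Variables (s : gal_of {:K}) (a : K).

(* The pair (u, v) stands for the element u + v t of K (+) K t. *)
Definition naquat_mul (x y : (K * K)%type) : (K * K)%type :=
  (x.1 * y.1 + x.2 * s y.2 * a, x.1 * y.2 + x.2 * s y.1).

Lemma naquat_mul_linear_r x : linear (naquat_mul x).
Proof.
move=> c y z; rewrite /naquat_mul /=; congr pair; rewrite /= linearP.
  by rewrite !mulrDr mulrDl -!scalerAr -!scalerAl scalerDr addrACA.
by rewrite !mulrDr -!scalerAr scalerDr addrACA.
Qed.

Lemma naquat_mul_linear_l y : linear (naquat_mul^~ y).
Proof.
move=> c x z; rewrite /naquat_mul /=; congr pair; rewrite /=.
  by rewrite !mulrDl -!scalerAl scalerDr addrACA.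
by rewrite !mulrDl -!scalerAl scalerDr addrACA.
Qed.

Lemma naquat_mul1x : left_id (1, 0) naquat_mul.
Proof. by case=> u v; rewrite /naquat_mul /= !mul1r !mul0r !addr0. Qed.

Lemma naquat_mulx1 : right_id (1, 0) naquat_mul.
Proof.
case=> u v; rewrite /naquat_mul /= rmorph0 rmorph1.
by rewrite !mulr0 !mulr1 mul0r addr0 add0r.
Qed.

Definition naquat : naAlgebra F :=
  NAAlgebra naquat_mul_linear_r naquat_mul_linear_l naquat_mul1x naquat_mulx1.

End NonassocQuaternion.

(* Proper nonassociative quaternion algebras over F, up to isomorphism. *)
Definition is_naquat (F : fieldType) (A : naAlgebra F) : Prop :=
  exists (K : splittingFieldType F) (s : gal_of {:K}) (a : K),
    [/\ \dim {:K} = 2%N, galois 1 {:K}, s != 1%g, a \notin 1%VS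
      & na_isomorphic A (naquat s a)].

(* T is a set of representatives of the quotient of (F, +) by {0, 1}. *)
Definition is_transversal01 (F : fieldType) (T : set F) : Prop :=
  forall x : F, exists! s, T s /\ (x - s = 0 \/ x - s = 1).

Definition quat_params (F : fieldType) (K : fieldExtType F) (T : set F)
    (alpha : K) (gamma : F) : set K :=
  [set a | exists2 s, T s &
             a = s%:A + alpha \/ a = gamma *: (s%:A + alpha)].

(* Main.v *)
Require Import Defs.
From HB Require Import structures.
From mathcomp Require Import all_boot all_order all_algebra all_field.
From mathcomp Require Import boolp classical_sets.
From mathcomp Require Import zify ring.

Set Implicit Arguments.
Unset Strict Implicit.
Unset Printing Implicit Defensive.

Import Order.TTheory GRing.Theory Num.Theory.
Local Open Scope ring_scope.

(** Two quaternion algebras built on the same quadratic extension K of F are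
    isomorphic exactly when their parameters satisfy
    [phi a = v * sigma v * b] for some v != 0 in K and some automorphism phi
    of K over F.  Indeed an isomorphism preserves the left nucleus K, hence
    restricts to such a phi, and the relation t x = sigma(x) t forces t to go
    to a multiple v t; squaring t gives the formula ([naquat_iso_of],
    [naquat_iso_inv]).  So the classification is that of K minus F under the
    norm group N and the automorphism group, and alpha |-> alpha + 1 is the
    only nontrivial automorphism.

    Write a = x + y alpha = y (x / y + alpha) with y != 0.  If N has index two
    in the multiplicative group of F, exactly one of y and gamma y is a norm,
    so a can be moved to s + alpha or gamma (s + alpha), where s = x / y
    matters only up to adding 1, the effect of sigma.  Comparing
    coordinates on the basis 1, alpha shows that no further identification
    occurs ([quat_params_exists], [quat_params_inj]).  An arbitrary algebra
    with left nucleus K comes from some other extension K', but its left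
    nucleus is K' as well, which provides an isomorphism from K to K' along
    which the parameter is transported ([left_nucleus_embedding],
    [iso_semilinear]).

    What remains is the arithmetic input, that the product of two non-norms is
    a norm ([value_group_index2]).  The norm of x + y alpha is
    x^2 + x y + c y^2, and c may be changed by any z^2 + z.  Removing even
    poles in this way leaves c with a pole of order m, where m = 0 or m is odd.
    Since z^2 + z = b is solvable for b without constant term or pole, every
    u = 1 + O(t^(m+1)) is a norm.  Squares are norms as well.
    - If m = 0, these two facts make every series of even valuation a norm,
      and two non-norms have odd valuations.
    - If m is odd, c is a norm of odd valuation, and the norms
      1 + y + c y^2 together with squares allow to bring any series
      to the form 1 + a t^m + O(t^(m+1)) modulo norms.  With y = e t^m they
      change a by e + r e^2, where r is the leading coefficient of c; this
      additive map of the finite residue field has kernel of order two, so its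
      image has index two. *)

(** * Valuations of Laurent series *)

Section LaurentOrder.
Variable k : fieldType.
Implicit Types f g h : laurent k.

(** Orders are bounded from below rather than computed, which avoids choosing a
    value for the order of the zero series. *)
Definition ord_ge f (n : int) : Prop := forall i, i < n -> f i = 0.

Definition mono_coef (a : k) (n i : int) : k := a *+ (i == n).

Lemma mono_subproof a n :
  exists N : int, forall i, i < N -> mono_coef a n i = 0.
Proof. by exists n => i lt_in; rewrite /mono_coef lt_eqF. Qed.

Definition mono a n : laurent k := Laurent (mono_subproof a n).

Lemma lcoefD f g i : (f + g) i = f i + g i. Proof. by []. Qed.

Lemma lcoefN f i : (- f) i = - f i. Proof. by []. Qed.

Lemma mono_lead a n : mono a n n = a.
Proof. by rewrite /= /mono_coef eqxx. Qed.

Lemma ord_mono a n : ord_ge (mono a n) n.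
Proof. by move=> i lt_in; rewrite /= /mono_coef lt_eqF. Qed.

Lemma ord_geW f (m n : int) : m <= n -> ord_ge f n -> ord_ge f m.
Proof. by move=> le_mn hf i lt_im; apply/hf/(lt_le_trans lt_im). Qed.

Lemma ord_geS f n : ord_ge f n -> f n = 0 -> ord_ge f (n + 1).
Proof.
by move=> hf fn0 i; rewrite ltzD1 le_eqVlt => /predU1P[-> //|]; apply: hf.
Qed.

Lemma ord_geD f g n : ord_ge f n -> ord_ge g n -> ord_ge (f + g) n.
Proof. by move=> hf hg i lt_in; rewrite lcoefD hf ?hg ?addr0. Qed.

Lemma ord_geM f g m n : ord_ge f m -> ord_ge g n -> ord_ge (f * g) (m + n).
Proof. exact: lconv_bounded. Qed.

Lemma ord_geX f (m n : nat) : ord_ge f m%:Z -> ord_ge (f ^+ n) (m * n)%N%:Z.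
Proof.
move=> hf; elim: n => [|n IHn].
  by rewrite muln0 expr0 => i lt_i0; rewrite /= (lt_eqF lt_i0).
by rewrite exprS mulnS PoszD; apply: ord_geM.
Qed.

(** Leading coefficients multiply: the convolution has a single term there. *)
Lemma lcoefM_lead f g m n :
  ord_ge f m -> ord_ge g n -> (f * g) (m + n) = f m * g n.
Proof.
move=> hf hg; have := lconvE 0 hf hg.
by rewrite addr0 big_ord1 /= !addr0.
Qed.

Lemma ord_ge_eq0 f : (forall n : nat, ord_ge f n%:Z) -> f = 0.
Proof. by move=> hf; apply: laurentP => i; apply: (hf `|i|.+1); lia. Qed.

Definition unit_lvl (n : nat) f : Prop := ord_ge (f - 1) n%:Z.

(** On the n-th layer of the filtration of one-units, multiplication is addition
    of the coefficients of t^n; this is why the norm group can be studied one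
    coefficient at a time. *)
Lemma unit_lvlM n f g : (0 < n)%N -> unit_lvl n f -> unit_lvl n g ->
  unit_lvl n (f * g) /\ (f * g - 1) n = (f - 1) n + (g - 1) n.
Proof.
move=> n_gt0 hf hg.
have hfg : ord_ge ((f - 1) * (g - 1)) (n%:Z + 1).
  by apply: ord_geW (ord_geM hf hg); lia.
rewrite /unit_lvl; have -> : f * g - 1 = (f - 1) + (g - 1) + (f - 1) * (g - 1).
  by ring.
split.
  by apply: ord_geD (ord_geD hf hg) (ord_geW _ hfg); lia.
by rewrite !lcoefD (hfg n) ?addr0 //; lia.
Qed.

Lemma unit_lvl_neq0 n f : (0 < n)%N -> unit_lvl n f -> f != 0.
Proof.
move=> n_gt0 hf; apply: contraTneq isT => f0.
have := hf 0; rewrite f0 sub0r lcoefN /= => /(_ n_gt0)/eqP.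
by rewrite oppr_eq0 oner_eq0.
Qed.

End LaurentOrder.

(** * The norm form of an Artin-Schreier extension *)

Section QuadraticForm.
Variable R : comNzRingType.
Implicit Types c x y z u v g h : R.

Definition as_map z : R := z ^+ 2 + z.

Definition qform c x y : R := x ^+ 2 + x * y + c * y ^+ 2.

Definition is_value c g : Prop := exists x y, g = qform c x y.

Lemma as_mapD2 : 2 = 0 :> R -> {morph as_map : x y / x + y}.
Proof.
(* Adding a suitable multiple of 2 turns the claim into a ring identity; the
   same device is used for the other identities of characteristic two. *)
move=> two0 x y; rewrite -[RHS]addr0 -(mul0r (x * y)) -two0 /as_map.
by ring.
Qed.

(** The form is the norm x^2 + x y + c y^2 of x + y b where b^2 = b - c, and the
    right-hand side gives the coordinates of a product. *)
Lemma qformM c x y u v :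
  qform c x y * qform c u v =
  qform c (x * u - c * y * v) (x * v + y * u + y * v).
Proof. by rewrite /qform; ring. Qed.

Lemma is_valueM c g h : is_value c g -> is_value c h -> is_value c (g * h).
Proof.
by move=> [x [y ->]] [u [v ->]]; rewrite qformM; do 2!eexists; reflexivity.
Qed.

Lemma is_value_sqr c x : is_value c (x ^+ 2).
Proof. by exists x, 0; rewrite /qform; ring. Qed.

Lemma is_value_param c : is_value c c.
Proof. by exists 0, 1; rewrite /qform; ring. Qed.

Lemma qform_as c z x y : 2 = 0 :> R ->
  qform (c + as_map z) x y = qform c (x + z * y) y.
Proof.
move=> two0; rewrite -[LHS]addr0 -(mul0r (x * y * z)) -two0 /qform /as_map.
by ring.
Qed.

(** Replacing c by c + z^2 + z amounts to replacing the generator alpha by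
    alpha + z, which does not change the norm group. *)
Lemma is_value_as c z g : 2 = 0 :> R ->
  is_value (c + as_map z) g <-> is_value c g.
Proof.
move=> two0; split=> [[x [y ->]]|[x [y ->]]].
  by exists (x + z * y), y; rewrite qform_as.
by exists (x - z * y), y; rewrite qform_as // subrK.
Qed.

End QuadraticForm.

(** The nonzero values form a group: up to the square of h, dividing by h is
    multiplying by h. *)
Lemma is_value_cancel (F : fieldType) (c g h : F) :
  h != 0 -> is_value c h -> is_value c (g * h) -> is_value c g.
Proof.
move=> h0 vh vgh; have -> : g = g * h * h * h^-1 ^+ 2 by field.
by apply: is_valueM (is_valueM vgh vh) (is_value_sqr _ _).
Qed.

Lemma mulf_neq0r (R : pzRingType) (x y : R) : x * y != 0 -> y != 0.
Proof. by apply: contraNneq => ->; rewrite mulr0. Qed.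

Lemma is_value_cancel2 (F : fieldType) (c g h w z : F) :
    is_value c w -> is_value c z -> g * w != 0 -> h * z != 0 ->
  is_value c (g * w * (h * z)) -> is_value c (g * h).
Proof.
move=> vw vz /mulf_neq0r w0 /mulf_neq0r z0 v.
apply: (is_value_cancel w0 vw); apply: (is_value_cancel z0 vz).
by have -> : g * h * w * z = g * w * (h * z) by ring.
Qed.

(** * Artin-Schreier equations over Laurent series of characteristic two *)

Section CharTwo.
Variable k : fieldType.
Hypothesis char2 : 2 \in [pchar k].
Implicit Types b c f g h u w x y z : laurent k.

Lemma laurent_two0 : 2 = 0 :> laurent k.
Proof.
apply: laurentP => i; rewrite mulr2n lcoefD.
by rewrite (addrr_pchar2 char2).
Qed.

Lemma laurent_addrr f : f + f = 0.
Proof. by rewrite -mulr2n -mulr_natl laurent_two0 mul0r. Qed.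

(** Partial sums of b + b^2 + b^4 + ..., the formal solution of
    z^2 + z = b in characteristic two. *)
Definition as_sum b (n : nat) : laurent k := \sum_(i < n) b ^+ (2 ^ i).

Lemma as_map_sum b n : as_map (as_sum b n) = b + b ^+ (2 ^ n).
Proof.
elim: n => [|n IHn].
  by rewrite /as_sum big_ord0 /as_map expr0n addr0 expn0 expr1 laurent_addrr.
rewrite {1}/as_sum big_ord_recr /= as_mapD2; last exact: laurent_two0.
rewrite -/(as_sum b n) IHn /as_map -exprM -expnSr -addrA; congr (_ + _).
by rewrite addrCA laurent_addrr addr0.
Qed.

Lemma ord_pow2 b n : ord_ge b 1 -> ord_ge (b ^+ (2 ^ n)) n.+1%:Z.
Proof.
move=> hb; have := ord_geX (m := 1) (n := (2 ^ n)%N) hb; rewrite mul1n.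
by apply: ord_geW; rewrite lez_nat ltn_expl.
Qed.

Lemma as_sum_stable b n d : ord_ge b 1 ->
  ord_ge (as_sum b (n + d) - as_sum b n) n.+1%:Z.
Proof.
move=> hb; elim: d => [|d IHd]; first by rewrite addn0 subrr.
rewrite addnS {1}/as_sum big_ord_recr /= -/(as_sum b (n + d)) addrAC.
apply: ord_geD => //; apply: ord_geW (ord_pow2 hb).
by rewrite lez_nat ltnS leq_addr.
Qed.

(** The partial sums [as_sum b n] converge when b has positive order, and their
    limit z satisfies z^2 + z = b because the error b^(2^n) tends to 0.  The
    coefficient of t^i stabilizes from n = i on, which gives z directly. *)
Lemma as_map_surj b : ord_ge b 1 -> exists z, as_map z = b.
Proof.
move=> hb; pose zc (i : int) := as_sum b `|i| i.
have zP n i : i < n.+1%:Z -> zc i = as_sum b n i.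
  move=> lt_in; rewrite /zc; have [i_ge0|i_lt0] := lerP 0 i.
    have -> : n = (`|i| + (n - `|i|))%N by lia.
    have /(_ i) := as_sum_stable (n := `|i|%N) (n - `|i|) hb.
    rewrite lcoefD lcoefN => /(_ _)/eqP; rewrite subr_eq0 => /(_ _)/eqP-> //.
    by lia.
  have neg m : as_sum b m i = 0.
    have /(_ i) := as_sum_stable (n := 0) m hb.
    by rewrite add0n [as_sum b 0]big_ord0 subr0; apply; lia.
  by rewrite !neg.
have zbnd : exists N : int, forall i, i < N -> zc i = 0.
  exists 0 => i i_lt0; rewrite (zP 0%N); last by lia.
  by rewrite /as_sum big_ord0.
pose z := Laurent zbnd; exists z.
apply/eqP; rewrite -subr_eq0; apply/eqP/ord_ge_eq0 => n.
pose d := z - as_sum b n.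
have hd : ord_ge d n.+1%:Z.
  by move=> i lt_in; rewrite /d lcoefD lcoefN [z i](zP n) // subrr.
have -> : as_map z - b = d ^+ 2 + d + b ^+ (2 ^ n).
  rewrite -[z](subrK (as_sum b n)) -/d as_mapD2 ?as_map_sum; last first.
    exact: laurent_two0.
  by rewrite /as_map; ring.
apply: ord_geD; last by apply: ord_geW (ord_pow2 hb); lia.
apply: ord_geD; last by apply: ord_geW hd; lia.
by apply: ord_geW (ord_geX (n := 2) hd); lia.
Qed.

End CharTwo.

(** * The norm group has index at most two *)

Section FiniteResidueField.
Variables (e : nat) (k : finFieldType).
Hypotheses (e_gt0 : (0 < e)%N) (card_k : #|k| = (2 ^ e)%N).

Lemma residue_char2 : 2 \in [pchar k].
Proof. exact: card_finPcharP card_k _. Qed.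

Implicit Types c g h u : laurent k.

Let two0 : 2 = 0 :> laurent k := laurent_two0 residue_char2.

Lemma residue_sqrt (a : k) : exists b, b ^+ 2 = a.
Proof.
by exists (a ^+ (2 ^ e.-1)); rewrite -exprM -expnSr prednK // -card_k expf_card.
Qed.

(** The additive map x |-> x + r x^2 has kernel {0, 1/r}, so its image I has
    index two.  If none of a, b, a + b were in I, then I, a + I and b + I would
    be disjoint, although each contains half of the field. *)
Lemma residue_index2 (r a b : k) : r != 0 ->
    ~ (exists x, a = x + r * x ^+ 2) -> ~ (exists x, b = x + r * x ^+ 2) ->
  exists x, a + b = x + r * x ^+ 2.
Proof.
move=> r0 aN bN.
have ch2 := residue_char2; have oppE (x : k) : - x = x by apply: oppr_pchar2.
pose L x : k := x + r * x ^+ 2.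
have LD : {morph L : x y / x + y}.
  move=> x y; rewrite /L -[RHS]addr0 -(mul0r (r * x * y)) -(pcharf0 ch2).
  by ring.
pose I := L @: [set: k].
have I0 : 0 \in I by apply/imsetP; exists 0; rewrite ?inE // /L; ring.
have ID : {in I &, forall x y, x + y \in I}.
  by move=> _ _ /imsetP[x _ ->] /imsetP[y _ ->]; rewrite -LD imset_f ?inE.
have Ia : a \notin I by apply/imsetP => -[x _ ?]; apply: aN; exists x.
have Ib : b \notin I by apply/imsetP => -[x _ ?]; apply: bN; exists x.
have [/imsetP[x _ ->]|Iab] := boolP (a + b \in I); first by exists x.
have I2 : (#|k| <= #|I| * 2)%N.
  rewrite -cardsT -sum1_card (partition_big L (mem I)) => [|x _]; last first.
    by apply: imset_f; rewrite inE.
  rewrite -sum_nat_const; apply: leq_sum => y /imsetP[x0 _ ->].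
  rewrite sum1_card; apply: (@leq_trans #|[set x0; x0 + r^-1]|); last first.
    by rewrite cards2; case: (_ != _).
  apply: subset_leq_card; apply/fintype.subsetP => x.
  rewrite unfold_in => /andP[_ /eqP Lx]; rewrite !inE.
  have : (x - x0) * (1 + r * (x - x0)) = 0.
    by rewrite -(subrr (L x0)) -{1}Lx !oppE -LD /L; ring.
  move/eqP; rewrite mulf_eq0 subr_eq0 => /orP[->//|].
  rewrite addr_eq0 => /eqP rd1.
  have <- : x - x0 = r^-1 by apply: (mulfI r0); rewrite -[LHS]oppE -rd1 mulfV.
  by rewrite [x0 + _]addrC subrK eqxx orbT.
pose shift z : {set k} := (+%R z) @: I.
have shiftP z x : x \in shift z -> x + z \in I.
  by case/imsetP=> y Iy ->; rewrite addrAC -{2}(oppE z) subrr add0r.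
have card_shift z : #|shift z| = #|I| by apply/card_imset/addrI.
have dIa : [disjoint I & shift a].
  rewrite disjoint_subset; apply/fintype.subsetP => x Ix; rewrite inE.
  apply: contra Ia => /shiftP Ixa; have := ID _ _ Ix Ixa.
  by rewrite addrA -{1}(oppE x) addNr add0r.
have dIab : [disjoint I :|: shift a & shift b].
  rewrite disjoint_subset.
  apply/fintype.subsetP => x /setUP[Ix|/shiftP Ixa]; rewrite inE.
    apply: contra Ib => /shiftP Ixb; have := ID _ _ Ix Ixb.
    by rewrite addrA -{1}(oppE x) addNr add0r.
  apply: contra Iab => /shiftP Ixb; have := ID _ _ Ixa Ixb.
  by rewrite addrACA -{1}(oppE x) addNr add0r.
have : (#|I :|: shift a :|: shift b| <= #|k|)%N by rewrite max_card.
have I_gt0 : (0 < #|I|)%N by apply/card_gt0P; exists 0.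
move: dIab dIa; rewrite -!(leq_card_setU _ _).2 => /eqP -> /eqP ->.
by rewrite !card_shift; lia.
Qed.

(** A pole of even order n is removed by adding z^2 + z with z = b t^(-n/2),
    where b^2 is the leading coefficient: z has a pole of smaller order.  The
    process must stop before the order becomes positive, as [as_map_surj] would
    then solve z^2 + z = c. *)
Lemma as_reduce c : ~ (exists z, as_map z = c) ->
  exists z m, [/\ ord_ge (c + as_map z) (- m%:Z), (c + as_map z) (- m%:Z) != 0
    & m = 0%N \/ odd m].
Proof.
move=> cN; have [M cM] := lcoef_bounded c.
have [n hc] : exists n : nat, ord_ge c (- n%:Z).
  by exists `|M|%N; apply: ord_geW cM; lia.
clear M cM; elim: n c hc cN => [|n IHn] c hc cN.
  have [c0|c0] := eqVneq (c 0) 0.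
    by case: cN; apply: (as_map_surj residue_char2); apply: (ord_geS hc).
  by exists 0, 0%N; rewrite /as_map expr0n !addr0; split=> //; left.
have geS c' : ord_ge c' (- n.+1%:Z) -> c' (- n.+1%:Z) = 0 -> ord_ge c' (- n%:Z).
  by move=> hc' c'n; apply: ord_geW (ord_geS hc' c'n); lia.
have [cn0|cn0] := eqVneq (c (- n.+1%:Z)) 0; first exact/IHn/cN/geS.
have [odd_n|even_n] := boolP (odd n.+1).
  by exists 0, n.+1; rewrite /as_map expr0n !addr0; split=> //; right.
have [b b2] := residue_sqrt (c (- n.+1%:Z)).
pose N : int := - (n.+1./2)%:Z; pose z := mono b N.
have N2 : N + N = - n.+1%:Z by rewrite /N -{2}(even_halfK even_n); lia.
have hz2 : ord_ge (z ^+ 2) (- n.+1%:Z).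
  by rewrite -N2 expr2; apply: ord_geM; apply: ord_mono.
have hz : ord_ge z (- n.+1%:Z + 1) by apply: ord_geW (@ord_mono _ _ _); lia.
have hcz : ord_ge (c + as_map z) (- n%:Z).
  apply: geS; first by apply: ord_geD hc (ord_geD hz2 (ord_geW _ hz)); lia.
  rewrite !lcoefD (hz (- n.+1%:Z)); last by lia.
  rewrite addr0 -{2}N2 expr2 lcoefM_lead; try exact: ord_mono.
  by rewrite mono_lead -expr2 b2 (addrr_pchar2 residue_char2).
have czN : ~ (exists z', as_map z' = c + as_map z).
  case=> z' z'E; apply: cN; exists (z' + z).
  by rewrite (as_mapD2 two0) z'E -addrA (laurent_addrr residue_char2) addr0.
have [z' [m]] := IHn _ hcz czN.
by rewrite -addrA -(as_mapD2 two0) => H; exists (z + z'), m.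
Qed.

(** The residue field being perfect, an even leading monomial is a square. *)
Lemma square_class_unit g (N : int) : ord_ge g (N + N) -> g (N + N) != 0 ->
  exists x, unit_lvl 1 (g * x ^+ 2).
Proof.
move=> hg gN0; have [b b2] := residue_sqrt (g (N + N)).
have b0 : b != 0 by apply: contraNneq gN0 => b0; rewrite -b2 b0 expr0n.
pose x := mono b^-1 (- N); exists x.
have hx2 : ord_ge (x ^+ 2) (- N - N).
  by rewrite expr2; apply: ord_geM; apply: ord_mono.
have x2N : (x ^+ 2) (- N - N) = b^-1 ^+ 2.
  by rewrite !expr2 lcoefM_lead ?mono_lead //; apply: ord_mono.
have E : N + N + (- N - N) = 0 :> int by lia.
have gx0 : (g * x ^+ 2) 0 = 1.
  rewrite -[RHS](expr1n _ 2) -(mulfV b0) exprMn b2 -x2N -lcoefM_lead //.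
  by congr (lcoef _ _); lia.
rewrite /unit_lvl (_ : 1%:Z = 0 + 1) //; apply: ord_geS => [i i_lt0|].
  rewrite lcoefD lcoefN (ord_geM hg hx2) ?E //.
  by rewrite [(1 : laurent k) i]/= lt_eqF // subr0.
by rewrite lcoefD lcoefN gx0 /= subrr.
Qed.

Section ReducedParameter.
Variables (c : laurent k) (m : nat).
Hypotheses (hc : ord_ge c (- m%:Z)) (cm0 : c (- m%:Z) != 0).

Let c0 : c != 0. Proof. by apply: contraNneq cm0 => ->. Qed.

(** Multiplying 1 + y + c y^2 = u by c turns it into the Artin-Schreier equation
    z^2 + z = c (u - 1) for z = c y, with right-hand side of positive order. *)
Lemma value_deep_unit u : unit_lvl m.+1 u -> is_value c u.
Proof.
move=> hu; have [|z zE] := as_map_surj residue_char2 (b := c * (u - 1)).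
  by apply: ord_geW (ord_geM hc hu); lia.
exists 1, (z / c).
have -> : qform c 1 (z / c) = 1 + as_map z / c by rewrite /qform /as_map; field.
by rewrite zE; field.
Qed.

(** The value 1 + y + c y^2 at y = a t^N.  The term c y^2 lives in degree
    n = 2 N - m, which is below the degree N of y as long as n < m; at n = m
    both terms contribute. *)
Lemma value_unit (n N : nat) (a : k) : (n + m = N + N)%N -> (n <= N)%N ->
  exists w, [/\ is_value c w, unit_lvl n w
    & (w - 1) n = (if N == n then a else 0) + c (- m%:Z) * a ^+ 2].
Proof.
move=> nmN le_nN; pose y := mono a N; exists (qform c 1 y).
have -> : unit_lvl n (qform c 1 y) = ord_ge (y + c * y ^+ 2) n.
  by rewrite /unit_lvl; congr ord_ge; rewrite /qform; ring.
have -> : qform c 1 y - 1 = y + c * y ^+ 2 by rewrite /qform; ring.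
have hy : ord_ge y N := @ord_mono _ _ _.
have hy2 : ord_ge (y ^+ 2) (N + N)%:Z by rewrite expr2 PoszD; apply: ord_geM.
have E : n = - m%:Z + (N + N)%N :> int by lia.
split; first by exists 1, y.
  by apply: ord_geD; [apply: ord_geW hy; lia | rewrite E; apply: ord_geM].
rewrite lcoefD; congr (_ + _).
  by rewrite /= /mono_coef eqz_nat eq_sym; case: eqP.
rewrite E lcoefM_lead // expr2 PoszD lcoefM_lead //.
by rewrite mono_lead -expr2.
Qed.

(** Here every series of even valuation is a value, since all one-units are; two
    non-values thus have odd valuations, and their product an even one. *)
Lemma unramified_index2 g h : m = 0%N -> g != 0 -> h != 0 ->
  ~ is_value c g -> ~ is_value c h -> is_value c (g * h).
Proof.
move=> m0 g0 h0 gN hN.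
have even_value f (N : int) :
    ord_ge f (N + N) -> f (N + N) != 0 -> is_value c f.
  move=> hf fN; have [x hx] := square_class_unit hf fN.
  have x0 := mulf_neq0r (unit_lvl_neq0 (ltn0Sn 0) hx).
  apply: (is_value_cancel x0 (is_value_sqr _ _)).
  by apply: value_deep_unit; rewrite m0.
have odd_lead f : f != 0 -> ~ is_value c f ->
    exists N, ord_ge f (N + N + 1) /\ f (N + N + 1) != 0.
  move=> f0 fN; have [M [fM hM]] := laurent_lead f0.
  have [N [E|E]] : exists N : int, M = N + N \/ M = N + N + 1.
    by exists (M %/ 2)%Z; lia.
    by case: fN; apply: (even_value f N); rewrite -E.
  by exists N; rewrite -E.
have [N [hg gM]] := odd_lead _ g0 gN; have [P [hh hP]] := odd_lead _ h0 hN.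
have E : N + N + 1 + (P + P + 1) = (N + P + 1) + (N + P + 1) by lia.
apply: (even_value _ (N + P + 1)); rewrite -E; first exact: ord_geM.
by rewrite lcoefM_lead // mulf_neq0.
Qed.

(** The coefficients of t, ..., t^(m-1) are cleared one after the other: in odd
    degree by [value_unit], where the term c y^2 dominates, and in even degree
    by a square.  At the start, multiplying by c corrects an odd valuation. *)
Lemma unit_approx n g : odd m -> (0 < n <= m)%N -> g != 0 ->
  exists w, is_value c w /\ unit_lvl n (g * w).
Proof.
move=> odd_m /andP[n_gt0 le_nm] g0.
elim: n n_gt0 le_nm => // [[|n] IHn] _ le_nm.
  have [M [gM hM]] := laurent_lead g0.
  have [N [E|E]] : exists N : int, M = N + N \/ M - m%:Z = N + N.
  - have [N [E|E]] : exists N : int, M = N + N \/ M = N + N + 1.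
      by exists (M %/ 2)%Z; lia.
    + by exists N; left.
    + by exists (N - m./2%:Z); right; rewrite -{1}[m]odd_double_half odd_m; lia.
  - rewrite {}E in gM hM; have [x hx] := square_class_unit hM gM.
    by exists (x ^+ 2); split=> //; apply: is_value_sqr.
  - have hgc : ord_ge (g * c) (N + N) by rewrite -E; apply: ord_geM.
    have gcN : (g * c) (N + N) != 0 by rewrite -E lcoefM_lead // mulf_neq0.
    have [x hx] := square_class_unit hgc gcN.
    exists (c * x ^+ 2); rewrite mulrA; split=> //.
    exact: is_valueM (is_value_param _) (is_value_sqr _ _).
have [w [vw hw]] := IHn isT (ltnW le_nm).
suff [z [vz hz zE]] : exists z, [/\ is_value c z, unit_lvl n.+1 z
    & (z - 1) n.+1 = (g * w - 1) n.+1].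
  exists (w * z); split; first exact: is_valueM.
  have [hwz wzE] := unit_lvlM (ltn0Sn n) hw hz; rewrite mulrA.
  rewrite /unit_lvl -addn1 PoszD; apply: ord_geS => //.
  by rewrite wzE zE (addrr_pchar2 residue_char2).
set a := (g * w - 1) _; have [odd_n|even_n] := boolP (odd n.+1).
  have [b b2] := residue_sqrt (a / c (- m%:Z)).
  have [||z [vz hz zE]] := @value_unit n.+1 (n.+1 + m)./2 b.
  - by rewrite addnn even_halfK // oddD odd_n odd_m.
  - by rewrite geq_half_double -addnn leq_add2l ltnW.
  exists z; split=> //; rewrite zE b2 ifF; last by apply/eqP; lia.
  by rewrite add0r mulrC divfK.
have [b b2] := residue_sqrt a; pose N : nat := n.+1./2.
have N2 : n.+1 = (N + N)%N by rewrite addnn even_halfK.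
pose y := mono b N; have hy : ord_ge y N := @ord_mono _ _ _.
have sqE : (1 + y) ^+ 2 - 1 = y * y.
  by rewrite -[RHS]addr0 -(mul0r y) -two0; ring.
exists ((1 + y) ^+ 2); split; first exact: is_value_sqr.
  by rewrite /unit_lvl sqE N2 PoszD; apply: ord_geM.
by rewrite sqE {1}N2 PoszD lcoefM_lead // mono_lead -expr2.
Qed.

(** Modulo values, g and h become 1 + a t^m and 1 + b t^m up to higher terms.
    Being non-values, they have a and b outside the image of
    x |-> x + r x^2, where r is the leading coefficient of c; then a + b lies
    in it by [residue_index2], which makes the product a value. *)
Lemma ramified_index2 g h : odd m -> g != 0 -> h != 0 ->
  ~ is_value c g -> ~ is_value c h -> is_value c (g * h).
Proof.
move=> odd_m g0 h0 gN hN; have m_gt0 : (0 < m)%N by apply: odd_gt0.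
have value_lvl u a : unit_lvl m u -> (u - 1) m = a + c (- m%:Z) * a ^+ 2 ->
    is_value c u.
  move=> hu uE; have [w [vw hw]] := @value_unit m m a erefl (leqnn m).
  rewrite eqxx => wE.
  apply: (is_value_cancel (unit_lvl_neq0 m_gt0 hw) vw).
  have [huw uwE] := unit_lvlM m_gt0 hu hw.
  apply: value_deep_unit; rewrite /unit_lvl -addn1 PoszD; apply: ord_geS => //.
  by rewrite uwE uE wE (addrr_pchar2 residue_char2).
have mm : (0 < m <= m)%N by rewrite m_gt0 /=.
have [w [vw hw]] := unit_approx odd_m mm g0.
have [z [vz hz]] := unit_approx odd_m mm h0.
have gw0 := unit_lvl_neq0 m_gt0 hw; have hz0 := unit_lvl_neq0 m_gt0 hz.
apply: (is_value_cancel2 vw vz gw0 hz0).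
have outside f x : is_value c x -> ~ is_value c f -> unit_lvl m (f * x) ->
    ~ (exists a, (f * x - 1) m = a + c (- m%:Z) * a ^+ 2).
  move=> vx fN hfx [a /(value_lvl _ _ hfx) vfx]; apply: fN.
  have x0 := mulf_neq0r (unit_lvl_neq0 m_gt0 hfx).
  exact: is_value_cancel vx vfx.
have [a aE] := residue_index2 cm0 (outside _ _ vw gN hw) (outside _ _ vz hN hz).
have [hwz wzE] := unit_lvlM m_gt0 hw hz.
by apply: (value_lvl _ a) => //; rewrite wzE.
Qed.

End ReducedParameter.

(** This is the part of local class field theory used below: as the values form
    a group, they have index at most two.  Adding some z^2 + z to c does not
    change them, so c may be taken as in [as_reduce]. *)
Lemma value_group_index2 c g h : ~ (exists z, as_map z = c) ->
  g != 0 -> h != 0 -> ~ is_value c g -> ~ is_value c h -> is_value c (g * h).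
Proof.
move=> cN g0 h0 gN hN; have [z [m [hc cm m_odd]]] := as_reduce cN.
apply: (proj1 (is_value_as c z (g * h) two0)).
have gN' : ~ is_value (c + as_map z) g by move/(proj1 (is_value_as c z g two0)).
have hN' : ~ is_value (c + as_map z) h by move/(proj1 (is_value_as c z h two0)).
by case: m_odd => [m0|odd_m];
  [apply: (unramified_index2 hc cm) | apply: (ramified_index2 hc cm)].
Qed.

End FiniteResidueField.

(** * Isomorphisms of nonassociative algebras *)

Section NaIso.
Variable F : fieldType.
Implicit Types A B C : naAlgebra F.

Lemma na_iso_refl A : na_isomorphic A A.
Proof. by exists idfun; split=> //; exists id. Qed.

Lemma na_iso_sym A B : na_isomorphic A B -> na_isomorphic B A.
Proof.
case=> f [[g fK gK] fM].
have glin : linear g.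
  by move=> a x y; apply: (can_inj fK); rewrite gK linearP !gK.
pose g' : {linear B -> A} := HB.pack g (GRing.isLinear.Build _ _ _ _ g glin).
exists g'; split; first by exists f.
by move=> x y; apply: (can_inj fK); rewrite fM !gK.
Qed.

Lemma na_iso_trans A B C :
  na_isomorphic A B -> na_isomorphic B C -> na_isomorphic A C.
Proof.
case=> f [bf fM] [g [bg gM]]; exists (g \o f : {linear A -> C}).
by split=> [|x y]; [apply: bij_comp | rewrite /= fM gM].
Qed.

End NaIso.

(** * Separable quadratic extensions *)

Section QuadraticExtension.
Variables (F : fieldType) (K : splittingFieldType F).
Hypothesis dimK : \dim {:K} = 2%N.
Implicit Types (s : gal_of {:K}) (a x : K).

Lemma quad_basis a x : a \notin 1%VS -> exists p q : F, x = p%:A + q *: a.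
Proof.
move=> aN; have : x \in (1 + <[a]>)%VS.
  suff /eqP -> : (1 + <[a]>)%VS == {:K}%VS by rewrite memvf.
  rewrite eqEdim subvf dimK ltn_neqAle.
  have [] := dimv_leqif_eq (addvSl 1%VS <[a]>%VS); rewrite dimv1 => -> ->.
  rewrite andbT; apply: contra aN => /eqP ->.
  by rewrite (subvP (addvSr _ _)) ?memv_line.
by case/memv_addP=> _ /vlineP[p ->] [_ /vlineP[q ->] ->]; exists p, q.
Qed.

Lemma gal_scalar s (p : F) : s p%:A = p%:A.
Proof. by rewrite linearZ rmorph1. Qed.

Lemma gal_moves s a : s != 1%g -> a \notin 1%VS -> s a != a.
Proof.
move=> s1 aN; apply: contra s1 => /eqP sa; apply/gal_eqP => x _.
have [p [q ->]] := quad_basis x aN.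
by rewrite gal_id linearD /= gal_scalar linearZ /= sa.
Qed.

Lemma moved_notin1 s a : s a != a -> a \notin 1%VS.
Proof. by apply: contra => /vlineP[p ->]; rewrite gal_scalar. Qed.

Lemma quad_coord_inj a (p q p' q' : F) : a \notin 1%VS ->
  p%:A + q *: a = p'%:A + q' *: a -> p = p' /\ q = q'.
Proof.
move=> aN /eqP; rewrite -subr_eq0 opprD addrACA -!scalerBl => /eqP E.
have qq : q = q'.
  apply/eqP; rewrite -subr_eq0; apply: contraNT aN => q0.
  apply/vlineP; exists (- (p - p') / (q - q')).
  apply: (scalerI q0); rewrite scalerA mulrC divfK //.
  by rewrite scaleNr; apply/eqP; rewrite -addr_eq0 addrC E.
split=> //; move/eqP: E; rewrite qq subrr scale0r addr0.
by rewrite scaler_eq0 oner_eq0 orbF subr_eq0 => /eqP.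
Qed.

Hypothesis sepK : separable 1 {:K}.

Lemma quad_galois : galois 1 {:K}.
Proof. by rewrite /galois sub1v sepK normalFieldf. Qed.

Lemma quad_gal s : s != 1%g -> 'Gal({:K} / 1)%g = [set (1%g : gal_of {:K}); s].
Proof.
move=> s1; apply/esym/eqP; rewrite eqEcard.
rewrite -(galois_dim quad_galois) dimv1 divn1 dimK cards2 eq_sym s1 andbT.
apply/fintype.subsetP => t _; by rewrite gal_kHom ?sub1v // k1AHom.
Qed.

Lemma quad_galNorm s x : s != 1%g -> galNorm 1 {:K} x = x * s x.
Proof.
move=> s1; rewrite /galNorm (quad_gal s1) big_setU1 ?inE 1?eq_sym //=.
by rewrite big_set1 gal_id.
Qed.

End QuadraticExtension.

(** * The left nucleus of a nonassociative quaternion algebra *)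

Section LeftNucleus.
Variable F : fieldType.

Lemma left_nucleus_iso (A B : naAlgebra F) (f : {linear A -> B}) :
    bijective f -> (forall x y, f (na_mul x y) = na_mul (f x) (f y)) ->
  forall x, @left_nucleus F B (f x) <-> @left_nucleus F A x.
Proof.
move=> [g fK gK] fM x; split=> nuc y z.
  by apply: (can_inj fK); rewrite !fM; apply: nuc.
by rewrite -(gK y) -(gK z) -!fM nuc.
Qed.

Lemma has_left_nucleus_iso (A B : naAlgebra F) (K : fieldExtType F) :
  na_isomorphic A B -> has_left_nucleus A K -> has_left_nucleus B K.
Proof.
case=> f [bf fM] [i [i_inj i1 iM iE]]; have [g fK gK] := bf.
have f1 : f (na_one A) = na_one B.
  have : na_mul (f (na_one A)) (f (g (na_one B))) = f (g (na_one B)).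
    by rewrite -fM na_mul1x.
  by rewrite gK na_mulx1.
exists (f \o i : {linear K -> B}); split=> /=.
- exact: inj_comp (can_inj fK) i_inj.
- by rewrite i1 f1.
- by move=> x y; rewrite iM fM.
apply/seteqP; split=> [_ [x _ <-]|y] /=.
  by apply/(left_nucleus_iso bf fM); rewrite -iE; exists x.
rewrite -(gK y) => /(left_nucleus_iso bf fM); rewrite -iE => -[x _ <-].
by exists x.
Qed.

Variables (K : splittingFieldType F) (s : gal_of {:K}) (a : K).
Hypothesis sa : s a != a.

(** The element t = (0, 1) detects the nucleus: ((u + v t) t) t and
    (u + v t) (t t) differ by (v a - v s(a)) t, so v = 0. *)
Lemma left_nucleus_naquat :
  @left_nucleus F (naquat s a) = [set x | x.2 = 0]%classic.
Proof.
apply/seteqP; split=> [[u v] /= nuc|[u v] /= -> [x y] [z w]].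
  have /= := congr1 snd (nuc (0, 1) (0, 1)).
  rewrite /= /naquat_mul /= !rmorph0 !rmorph1.
  rewrite !(mulr0, mulr1, add0r, addr0, mul0r, mul1r) => /eqP.
  rewrite -subr_eq0 -mulrBr mulf_eq0 subr_eq0 [a == _]eq_sym (negPf sa) orbF.
  by move/eqP.
rewrite /= /naquat_mul /= !mul0r !addr0; congr pair; ring.
Qed.

Definition naquat_inl (x : K) : naquat s a := (x, 0).

Lemma naquat_inl_linear : linear naquat_inl.
Proof. by move=> c x y; congr pair; rewrite /= scaler0 addr0. Qed.

HB.instance Definition _ :=
  GRing.isLinear.Build F K (naquat s a) _ naquat_inl naquat_inl_linear.

Lemma naquat_inlM x y :
  naquat_inl (x * y) = na_mul (naquat_inl x) (naquat_inl y).
Proof. by congr pair; rewrite /= ?rmorph0; ring. Qed.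

Lemma range_naquat_inl : range naquat_inl = @left_nucleus F (naquat s a).
Proof.
rewrite left_nucleus_naquat; apply/seteqP; split=> [_ [x _ <-] //|[x y] /= ->].
by exists x.
Qed.

Lemma naquat_has_left_nucleus : has_left_nucleus (naquat s a) K.
Proof.
exists (naquat_inl : {linear _ -> _}); split=> //; first by move=> x y [].
  exact: naquat_inlM.
exact: range_naquat_inl.
Qed.

(** An abstract identification j of a field E with the left nucleus is an
    isomorphism of E with the field K from which the algebra is built. *)
Lemma left_nucleus_embedding (E : fieldExtType F)
    (j : {linear E -> naquat s a}) :
    injective j -> (forall x y, j (x * y) = na_mul (j x) (j y)) ->
    range j = @left_nucleus F (naquat s a) ->
  exists phi : {linear E -> K}, [/\ bijective phi, {morph phi : x y / x * y}
    & forall x, j x = (phi x, 0)].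
Proof.
move=> j_inj jM jE; pose phi x : K := (j x).1.
have jphi x : j x = (phi x, 0).
  have : range j (j x) by exists x.
  by rewrite jE left_nucleus_naquat /phi => /=; case: (j x) => u v /= ->.
have phi_lin : linear phi by move=> c x y; rewrite /phi linearP.
pose phi' : {linear E -> K} :=
  HB.pack phi (GRing.isLinear.Build _ _ _ _ phi phi_lin).
exists phi'; split=> //=.
  have phi_inj : injective phi.
    by move=> x y xy; apply: j_inj; rewrite !jphi xy.
  have /choice[psi psiK] : forall y, exists x, phi x = y.
    move=> y; have : range j (y, 0) by rewrite jE left_nucleus_naquat.
    by case=> x _ jx; exists x; rewrite /phi jx.
  by exists psi => // x; apply: phi_inj; rewrite psiK.
move=> x y; rewrite /phi jM !jphi /= rmorph0; ring.
Qed.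

End LeftNucleus.

(** * The isomorphism criterion *)

Section Isomorphism.
Variables (F : fieldType) (K K' : splittingFieldType F).
Variables (s : gal_of {:K}) (s' : gal_of {:K'}) (a : K) (b : K').

(** The isomorphism extends phi by t |-> v t, and (v t)^2 = v s'(v) b. *)
Lemma naquat_iso_of (phi : {linear K -> K'}) (v : K') :
  bijective phi -> {morph phi : x y / x * y} -> phi \o s =1 s' \o phi ->
  v != 0 -> phi a = v * s' v * b -> na_isomorphic (naquat s a) (naquat s' b).
Proof.
move=> [psi phiK psiK] phiM phis v0 ab.
pose f (x : naquat s a) : naquat s' b := (phi x.1, phi x.2 * v).
have flin : linear f.
  move=> c x y; rewrite /f /= !linearP /=; congr pair.
  by rewrite mulrDl -scalerAl.
pose f' : {linear naquat s a -> naquat s' b} :=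
  HB.pack f (GRing.isLinear.Build _ _ _ _ f flin).
exists f'; split.
  exists (fun y => (psi y.1, psi (y.2 / v))) => -[x y]; rewrite /= /f /=.
    by rewrite mulfK // !phiK.
  by rewrite !psiK divfK.
move=> [x y] [u w]; rewrite /= /f /naquat_mul /=.
have phis_ z : phi (s z) = s' (phi z) := phis z.
rewrite !linearD /= !phiM !phis_ rmorphM /= ab; congr pair; last by ring.
by ring.
Qed.

(** An isomorphism f restricts to phi on the left nuclei.  Write f t = u + v t.
    Applying f to t x = s(x) t gives u phi(x) = phi(s x) u, whence u = 0, and
    v s'(phi x) = phi(s x) v, whence phi commutes with s and s' as v != 0.
    Applying it to t^2 = a gives the last equation. *)
Lemma naquat_iso_inv : s a != a -> s' b != b ->
    na_isomorphic (naquat s a) (naquat s' b) ->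
  exists (phi : {linear K -> K'}) (v : K'),
    [/\ bijective phi, {morph phi : x y / x * y}, phi \o s =1 s' \o phi,
      v != 0 & phi a = v * s' v * b].
Proof.
move=> sa sb [f [bf fM]]; have [g fK gK] := bf.
pose j : {linear K -> naquat s' b} := f \o @naquat_inl F K s a.
have [|||phi [bphi phiM jphi]] := @left_nucleus_embedding F K' s' b sb K j.
- by move=> x y /(can_inj fK) [].
- by move=> x y; rewrite /= naquat_inlM fM.
- apply/seteqP; split=> [_ [x _ <-]|y] /=.
    by apply/(left_nucleus_iso bf fM); rewrite -range_naquat_inl //; exists x.
  rewrite -(gK y) => /(left_nucleus_iso bf fM).
  by rewrite -range_naquat_inl // => -[x _ <-]; exists x.
have {jphi} fphi x : f (x, 0) = (phi x, 0) := jphi x.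
pose t : naquat s a := (0, 1); case ft : (f t) => [u v].
have comm_t x : na_mul t (x, 0) = na_mul ((s x, 0) : naquat s a) t.
  by congr pair; rewrite /= ?rmorph0 ?rmorph1; ring.
have fcomm x : u * phi x = phi (s x) * u /\ v * s' (phi x) = phi (s x) * v.
  have := congr1 f (comm_t x); rewrite !fM !fphi ft => -[].
  rewrite !rmorph0 !(mulr0, mul0r, add0r, addr0) => E1 E2; split=> //.
have u0 : u = 0.
  have [/eqP E _] := fcomm a; move: E; rewrite mulrC -subr_eq0 -mulrBl mulf_eq0.
  rewrite subr_eq0 (bij_eq bphi) eq_sym (negPf sa) => /eqP //.
have v0 : v != 0.
  apply: contraTneq isT => v0; have : f t = f 0 by rewrite ft u0 v0 linear0.
  by move/(can_inj fK) => [] /eqP; rewrite oner_eq0.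
exists phi, v; split=> //.
  by move=> x /=; have [_ E] := fcomm x; apply: (mulIf v0); rewrite -E mulrC.
have tt : na_mul t t = (a, 0) by congr pair; rewrite /= ?rmorph0 ?rmorph1; ring.
have := congr1 f tt; rewrite fM fphi ft u0 => -[<- _]; ring.
Qed.

End Isomorphism.

(** * Classification over an Artin-Schreier extension *)

Lemma as_map_eq (E : fieldType) (x y : E) :
  2 = 0 :> E -> as_map x = as_map y -> x = y \/ x = y + 1.
Proof.
move=> two0 xy; have : (x - y) * (x - (y + 1)) = 0.
  rewrite -[RHS](subrr (as_map y)) -{1}xy -[RHS]addr0.
  rewrite -(mul0r (y ^+ 2 - x * y - x + y)) -two0.
  by rewrite /as_map; ring.
by move/eqP; rewrite mulf_eq0 !subr_eq0 => /orP[] /eqP ->; [left | right].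
Qed.

Lemma gal_bij (F : fieldType) (K : splittingFieldType F) (s : gal_of {:K}) :
  bijective s.
Proof.
exists (s^-1)%g => x.
  by rewrite -galM ?memvf // mulgV gal_id.
by rewrite -galM ?memvf // mulVg gal_id.
Qed.

Section ArtinSchreier.
Variables (F : fieldType) (K : splittingFieldType F) (sigma : gal_of {:K}).
Variables (c : F) (alpha : K).
Hypotheses (two0 : 2 = 0 :> F) (dimK : \dim {:K} = 2%N).
Hypothesis as_alpha : as_map alpha = c%:A.
Hypothesis sigma_alpha : sigma alpha = alpha + 1.

Lemma ext_two0 (E : fieldExtType F) : 2 = 0 :> E.
Proof. by rewrite -(rmorph_nat (in_alg E) 2) two0 rmorph0. Qed.

Let twoK0 : 2 = 0 :> K := ext_two0 K.

Lemma sigma_moves : sigma alpha != alpha.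
Proof. by rewrite sigma_alpha -subr_eq0 addrAC subrr add0r oner_eq0. Qed.

Let alphaN := moved_notin1 sigma_moves.

Lemma sigma_neq1 : sigma != 1%g.
Proof. by apply: contraNneq sigma_moves => ->; rewrite gal_id. Qed.

Lemma as_param_nontrivial : ~ (exists z, as_map z = c).
Proof.
case=> z zc; have asz : as_map alpha = as_map (z%:A : K).
  by rewrite as_alpha -zc -!in_algE /as_map rmorphD rmorphXn.
move/negP: alphaN; apply; apply/vlineP.
case: (as_map_eq twoK0 asz) => ->; [by exists z | exists (z + 1)].
by rewrite scalerDl scale1r.
Qed.

Lemma norm_qform (x y : F) (z := x%:A + y *: alpha) :
  z * sigma z = (qform c x y)%:A.
Proof.
have zE : z = x%:A + y%:A * alpha by rewrite mulr_algl.
have -> : sigma z = x%:A + y%:A * (alpha + 1).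
  by rewrite zE rmorphD rmorphM /= !gal_scalar sigma_alpha.
have -> : (qform c x y)%:A =
    x%:A ^+ 2 + x%:A * y%:A + as_map alpha * y%:A ^+ 2 :> K.
  by rewrite as_alpha -[LHS]/(in_alg K _) !(rmorphD, rmorphM, rmorphXn).
rewrite zE -[RHS]addr0 -(mul0r (x%:A * y%:A * alpha)) -twoK0 /as_map.
by ring.
Qed.

Lemma norm_valueP (g : F) : g != 0 ->
  (exists2 z, z != 0 & z * sigma z = g%:A) <-> is_value c g.
Proof.
move=> g0; split=> [[z _]|[x [y gE]]].
  have [x [y ->]] := quad_basis dimK z alphaN.
  by rewrite norm_qform => /(fmorph_inj (in_alg K)) <-; exists x, y.
exists (x%:A + y *: alpha); last by rewrite norm_qform gE.
apply: contraNneq g0 => z0; apply/eqP/(fmorph_inj (in_alg K)).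
by rewrite rmorph0 /= gE -norm_qform z0 mul0r.
Qed.

Lemma iso_scalar (E : splittingFieldType F) (phi : {linear K -> E}) :
  bijective phi -> {morph phi : x y / x * y} -> forall p : F, phi p%:A = p%:A.
Proof.
move=> [psi phiK psiK] phiM p; rewrite linearZ; congr (_ *: _).
by rewrite -[LHS]mulr1 -(psiK 1) -phiM mul1r.
Qed.

Lemma iso_as_map (E : splittingFieldType F) (phi : {linear K -> E}) :
  bijective phi -> {morph phi : x y / x * y} -> as_map (phi alpha) = c%:A.
Proof.
move=> bphi phiM; rewrite -(iso_scalar bphi phiM) -as_alpha.
by rewrite /as_map linearD !expr2 phiM.
Qed.

(** An isomorphism phi of quadratic extensions intertwines their nontrivial
    automorphisms: s' must move the image of alpha to the only other root of
    x^2 + x + c, which is the image of alpha + 1. *)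
Lemma iso_semilinear (E : splittingFieldType F) (s' : gal_of {:E})
    (phi : {linear K -> E}) : \dim {:E} = 2%N -> s' != 1%g ->
  bijective phi -> {morph phi : x y / x * y} -> phi \o sigma =1 s' \o phi.
Proof.
move=> dimE s'1 bphi phiM; have phiA := iso_scalar bphi phiM.
have phi_alphaN : phi alpha \notin 1%VS.
  apply: contra alphaN => /vlineP[p]; rewrite -phiA => /(bij_inj bphi) ->.
  by apply/vlineP; exists p.
have asphi := iso_as_map bphi phiM.
have asE : as_map (s' (phi alpha)) = as_map (phi alpha).
  by rewrite asphi -(gal_scalar s') -asphi /as_map rmorphD rmorphXn.
have s'phi : s' (phi alpha) = phi alpha + 1.
  case: (as_map_eq (ext_two0 E) asE) => // /eqP.
  by rewrite (negPf (gal_moves dimE s'1 phi_alphaN)).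
move=> x; have [p [q ->]] := quad_basis dimK x alphaN.
have phi1 : phi 1 = 1 by have := phiA 1; rewrite !scale1r.
have phiE y : phi (p%:A + q *: y) = p%:A + q *: phi y.
  by rewrite linearD phiA linearZ.
rewrite /= phiE [sigma _]linearD /= gal_scalar linearZ /= sigma_alpha phiE.
rewrite linearD /= phi1.
by rewrite [RHS]linearD /= gal_scalar linearZ /= s'phi.
Qed.

Variables (gamma : F) (T : set F).
Hypotheses (gamma0 : gamma != 0) (gammaN : ~ is_value c gamma).
Hypothesis value_index2 : forall g h, g != 0 -> h != 0 ->
  ~ is_value c g -> ~ is_value c h -> is_value c (g * h).
Hypothesis transT : is_transversal01 T.

Lemma quat_paramsP (a : K) : quat_params T alpha gamma a <->
  exists g s, [/\ g = 1 \/ g = gamma, T s & a = g *: (s%:A + alpha)].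
Proof.
split=> [[s Ts [->|->]]|[g [s [gE Ts ->]]]].
- by exists 1, s; rewrite scale1r; split=> //; left.
- by exists gamma, s; split=> //; right.
by exists s => //; case: gE => ->; [left; rewrite scale1r | right].
Qed.

Lemma quat_params_notin1 (a : K) : quat_params T alpha gamma a -> a \notin 1%VS.
Proof.
case/quat_paramsP=> g [s [gE _ ->]]; have g0 : g != 0.
  by case: gE => ->; rewrite ?oner_eq0.
by rewrite rpredZeq (negPf g0) rpredDl ?rpredZ ?mem1v.
Qed.

(** With a = x + y alpha, the class of y modulo norms selects the factor 1 or
    gamma, and s is the representative of x / y.  The automorphism of K to use
    is the identity if s = x / y and sigma if s = x / y + 1. *)
Lemma quat_params_exists (a : K) : a \notin 1%VS ->
  exists2 b, quat_params T alpha gamma b &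
    na_isomorphic (naquat sigma a) (naquat sigma b).
Proof.
move=> aN; have [x [y aE]] := quad_basis dimK a alphaN.
have y0 : y != 0.
  apply: contraNneq aN => y0; apply/vlineP; exists x.
  by rewrite aE y0 scale0r addr0.
have [s [[Ts xs] _]] := transT (x / y).
have [g [gE g0 vg]] : exists g,
    [/\ g = 1 \/ g = gamma, g != 0 & is_value c (g / y)].
  have yV g : g / y = g * y * y^-1 ^+ 2 by field.
  have [vy|yN] := pselect (is_value c y).
    exists 1; rewrite oner_eq0 yV mul1r; split=> //; first by left.
    exact: is_valueM vy (is_value_sqr _ _).
  exists gamma; rewrite yV; split=> //; first by right.
  by apply: is_valueM (is_value_sqr _ _); apply: value_index2.
exists (g *: (s%:A + alpha)); first by apply/quat_paramsP; exists g, s.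
apply: na_iso_sym.
have gy0 : g / y != 0 by rewrite mulf_neq0 ?invr_eq0.
have [v v0 vE] := (norm_valueP gy0).2 vg.
have twist (phi : {linear K -> K}) : bijective phi ->
    {morph phi : x y / x * y} -> phi \o sigma =1 sigma \o phi ->
    phi (s%:A + alpha) = (x / y)%:A + alpha ->
    na_isomorphic (naquat sigma (g *: (s%:A + alpha))) (naquat sigma a).
  move=> bphi phiM phis phiE; apply: (naquat_iso_of bphi phiM phis v0).
  rewrite linearZ /= phiE vE aE mulr_algl !scalerDr !scalerA.
  by congr (_ *: _ + _ *: _); field.
case: xs => [/subr0_eq xs0|xs1].
  by apply: (twist idfun); rewrite ?xs0 //; exists id.
apply: (twist sigma).
- exact: gal_bij.
- exact: rmorphM.
- by [].
rewrite linearD /= gal_scalar sigma_alpha -[in RHS](subrK s (x / y)) xs1.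
by rewrite scalerDl scale1r; ring.
Qed.

(** Let a = g (s + alpha), b = h (t + alpha), with phi a = n b for a norm n.  As
    phi alpha is alpha + e with e in {0, 1}, the coordinates on the basis
    1, alpha give g = n h and s + e = t.  The former forces g = h since gamma is
    not a norm, and the latter s = t since s and t represent the same coset. *)
Lemma quat_params_inj (a b : K) :
  quat_params T alpha gamma a -> quat_params T alpha gamma b ->
  na_isomorphic (naquat sigma a) (naquat sigma b) -> a = b.
Proof.
move=> pa pb.
have aN := quat_params_notin1 pa; have bN := quat_params_notin1 pb.
have moves x := gal_moves dimK (a := x) sigma_neq1.
case/(naquat_iso_inv (moves _ aN) (moves _ bN))=> phi [v [bphi phiM _ v0 ab]].
move: pa pb ab {aN bN} => /quat_paramsP[g [s [gE Ts ->]]].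
case/quat_paramsP=> h [t [hE Tt ->]].
have [x [y vE]] := quad_basis dimK v alphaN; pose n := qform c x y.
have vvE : v * sigma v = n%:A by rewrite vE norm_qform.
have n0 : n != 0.
  apply: contraNneq v0 => n0; move/eqP: vvE.
  by rewrite n0 scale0r mulf_eq0 fmorph_eq0 orbb.
have [e e01 phi_alpha] :
    exists2 e : F, e = 0 \/ e = 1 & phi alpha = e%:A + alpha.
  have := iso_as_map bphi phiM; rewrite -as_alpha => /(as_map_eq twoK0)[] ->.
    by exists 0; [left | rewrite scale0r add0r].
  by exists 1; [right | rewrite scale1r addrC].
rewrite linearZ linearD /= phi_alpha (iso_scalar bphi phiM) vvE mulr_algl.
rewrite addrA -scalerDl !scalerDr !scalerA.
case/(quad_coord_inj alphaN) => gs gh.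
have vn : is_value c n by exists x, y.
have ghE : g = h.
  case: gE hE gh => -> [] -> //.
    move=> E; case: gammaN; have -> : gamma = n * n^-1 ^+ 2.
      rewrite expr2 mulrA mulfV // mul1r.
      by apply: (mulfI n0); rewrite -E mulfV.
    exact: is_valueM (is_value_sqr _ _).
  by rewrite mulr1 => E; case: gammaN; rewrite E.
have g0 : g != 0 by case: gE => ->; rewrite ?oner_eq0.
have stE : s + e = t by apply: (mulfI g0); rewrite gs [in RHS]gh !mulrA.
have [r [_ r_uniq]] := transT t.
have -> : s = t; last by rewrite ghE.
have <- : r = t by apply: r_uniq; split=> //; left; rewrite subrr.
apply/esym/r_uniq; split=> //.
by rewrite -stE addrAC subrr add0r.
Qed.

End ArtinSchreier.

Theorem theorem4p6 (f : nat) (k : finFieldType) (K : splittingFieldType (laurent k))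
    (c : laurent k) (alpha : K) (gamma : laurent k) (sigma : gal_of {:K})
    (T : set (laurent k)) :
  (0 < f)%N -> #|k| = (2 ^ f)%N ->
  irreducible_poly ('X^2 + 'X + c%:P) ->
  root (map_poly (in_alg K) ('X^2 + 'X + c%:P)) alpha ->
  <<1; alpha>>%VS = {:K}%VS ->
  \dim {:K} = 2%N -> separable 1 {:K} ->
  gamma != 0 ->
  ~ (exists2 z : K, z != 0 & galNorm 1 {:K} z = gamma%:A) ->
  sigma \in 'Gal({:K} / 1)%g -> sigma alpha = alpha + 1 ->
  is_transversal01 T ->
  (forall a, quat_params T alpha gamma a ->
     is_naquat (naquat sigma a) /\ has_left_nucleus (naquat sigma a) K) /\
  (forall A : naAlgebra (laurent k), is_naquat A -> has_left_nucleus A K ->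
     exists! a, quat_params T alpha gamma a /\ na_isomorphic A (naquat sigma a)).
Proof.
move=> f_gt0 card_k _ root_alpha _ dimK sepK gamma0 gammaN _ sigma_alpha transT.
have char2 := residue_char2 card_k.
have two0 : 2 = 0 :> laurent k := laurent_two0 char2.
have as_alpha : as_map alpha = c%:A.
  move: root_alpha; rewrite /root !rmorphD /= map_polyXn map_polyX map_polyC /=.
  rewrite !hornerE => /eqP E.
  rewrite -[RHS]add0r -E -[LHS]addr0 -(mul0r c%:A) -(ext_two0 two0 K) /as_map.
  by ring.
have sigma1 := sigma_neq1 sigma_alpha.
have gamma_nonvalue : ~ is_value c gamma.
  move/(norm_valueP two0 dimK as_alpha sigma_alpha gamma0) => [z z0 zE].
  by apply: gammaN; exists z; rewrite ?(quad_galNorm dimK sepK _ sigma1).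
have c_nontrivial := as_param_nontrivial two0 as_alpha sigma_alpha.
have index2 := value_group_index2 f_gt0 card_k c_nontrivial.
split=> [a pa|A [K' [s' [a' [dimK' _ s'1 a'N isoA]]]] nucA].
  have aN := quat_params_notin1 sigma_alpha gamma0 pa.
  split; last exact: naquat_has_left_nucleus (gal_moves dimK sigma1 aN).
  exists K, sigma, a; split=> //; first exact: quad_galois.
  exact: na_iso_refl.
(* The extension K' on which A is built need not be K, but the left nucleus of A
   is isomorphic to both. *)
have s'a' := gal_moves dimK' s'1 a'N.
have [j [j_inj _ jM jE]] := has_left_nucleus_iso isoA nucA.
have [phi [bphi phiM _]] := left_nucleus_embedding s'a' j_inj jM jE.
have [psi phiK psiK] := bphi.
have phis := iso_semilinear two0 dimK as_alpha sigma_alpha dimK' s'1 bphi phiM.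
pose a := psi a'.
have aN : a \notin 1%VS.
  apply: contra a'N => /vlineP[p ap]; apply/vlineP; exists p.
  by rewrite -(psiK a') -/a ap (iso_scalar bphi phiM).
have iso_a : na_isomorphic A (naquat sigma a).
  apply: na_iso_trans isoA (na_iso_sym _).
  apply: (naquat_iso_of bphi phiM phis (oner_neq0 K')).
  by rewrite psiK rmorph1 !mul1r.
have [b pb iso_b] := quat_params_exists two0 dimK as_alpha sigma_alpha
  gamma0 gamma_nonvalue index2 transT aN.
exists b; split=> [|b' [pb' iso_b']].
  by split=> //; apply: na_iso_trans iso_b.
apply: (quat_params_inj two0 dimK as_alpha sigma_alpha gamma0 gamma_nonvalue
  transT pb pb').
by apply: na_iso_trans iso_b'; apply/na_iso_sym/(na_iso_trans iso_a).
Qed.
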